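(* Let $r>0$ be rational, let $q\geq 2$ be an integer, and let $h\geq 1$ and $m\geq 3$ be integers with $\gcd(h,m)=1$ and $\frac{h}{m}<\frac12$. Then there exists $u\in\mathbb{N}$ such that \[ \frac{s_q\left(\lfloor u^{h/m}\rfloor\right)}{s_q(u)}=r. \]
   Context: For an integer $q\geq 2$ and $n\in\mathbb{N}$, $s_q(n)$ denotes the sum of the digits of $n$ written in base $q$. $\lfloor x\rfloor$ is the floor of $x$. *)

(* Defs.v *)
From mathcomp Require Import all_boot.

Set Implicit Arguments.
Unset Strict Implicit.
Unset Printing Implicit Defensive.

Definition digit (q n i : nat) : nat := (n %/ q ^ i) %% q.

(* For 2 <= q we have n < q ^ n, so every digit of n at a position i >= n is 0
   and the sum below runs over all the nonzero digits. *)
Definition digit_sum (q n : nat) : nat := \sum_(i < n) digit q n i.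

(* Main.v *)
(** Let [r = a / b]. Take a large power [Q] of [q], and put [A = Q ^ h],
    [n = g * q ^ k]. The number [v = A + (h n - 1)] carries a block of about [k]
    digits [q - 1], while [u0 = Q ^ (m - h) * (A + m n)] has few nonzero digits.
    The power [u0 ^ (h / m)] agrees with [A + h n] to first order in [n / A] but
    is smaller to second order, so its floor is [v]. Since [m > 2 h], this
    second-order gap leaves low digits of [u0] free: adding any
    [w < Q ^ (m - 2 h)] does not change the floor, and brings the digit sum of
    [u = u0 + w] to the desired value. Finally [g] and [k] are chosen so that [a]
    divides the digit sum of [v], with [k] so large that the value wanted for
    [u] is at least the digit sum of [u0]. *)

Require Import Defs.
From mathcomp Require Import all_boot all_order all_algebra.
From mathcomp Require Import reals exp.
From mathcomp Require Import zify.

Set Implicit Arguments.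
Unset Strict Implicit.
Unset Printing Implicit Defensive.

Import Order.TTheory GRing.Theory Num.Theory.

(** * Digit sums in base [q] *)

Lemma digit_sum_widen q n b : 1 < q -> n <= b ->
  \sum_(i < b) digit q n i = digit_sum q n.
Proof.
move=> q_gt1 le_nb.
rewrite /digit_sum -(big_mkord xpredT (digit q n)) (big_cat_nat (n := n)) //=.
rewrite big_mkord [X in _ + X]big1_seq ?addn0 // => i.
rewrite mem_index_iota /=.
case/andP=> le_ni _; rewrite /digit divn_small ?mod0n //.
exact: leq_ltn_trans le_ni (ltn_expl _ q_gt1).
Qed.

Lemma digit_sum_mulD q x d : 1 < q -> d < q ->
  digit_sum q (q * x + d) = digit_sum q x + d.
Proof.
move=> q_gt1 lt_dq; have q_gt0 : 0 < q by exact: ltnW.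
rewrite -(digit_sum_widen q_gt1 (leqnSn _)) big_ord_recl /=.
rewrite {1}/digit expn0 divn1 mulnC modnMDl modn_small // addnC.
congr (_ + _); rewrite -(@digit_sum_widen q x (x * q + d)) //; last by nia.
apply: eq_bigr => i _; rewrite /digit expnS divnMA.
by rewrite divnMDl // (divn_small lt_dq) addn0.
Qed.

Lemma digit_sum0 q : digit_sum q 0 = 0.
Proof. exact: big_ord0. Qed.

Lemma digit_sum_concat q e x y : 1 < q -> y < q ^ e ->
  digit_sum q (x * q ^ e + y) = digit_sum q x + digit_sum q y.
Proof.
move=> q_gt1; have q_gt0 : 0 < q by exact: ltnW.
elim: e x y => [|e IHe] x y.
  by rewrite expn0 ltnS leqn0 => /eqP ->; rewrite muln1 digit_sum0 !addn0.
rewrite expnSr => lt_y; have lt_yq : y %/ q < q ^ e by rewrite ltn_divLR.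
rewrite [in LHS](divn_eq y q) addnA mulnA -mulnDl mulnC.
rewrite digit_sum_mulD ?ltn_mod // IHe // -addnA; congr (_ + _).
by rewrite -digit_sum_mulD ?ltn_mod // mulnC -divn_eq.
Qed.

Lemma digit_sum_shift q e x : 1 < q -> digit_sum q (x * q ^ e) = digit_sum q x.
Proof.
move=> q_gt1; have qe_gt0 : 0 < q ^ e by rewrite expn_gt0 ltnW.
by have := digit_sum_concat x q_gt1 qe_gt0; rewrite digit_sum0 !addn0.
Qed.

Lemma digit_sum1 q : 1 < q -> digit_sum q 1 = 1.
Proof.
by move=> q_gt1; have := digit_sum_mulD 0 q_gt1 q_gt1; rewrite muln0 digit_sum0.
Qed.

Lemma digit_sum_expD q e y : 1 < q -> y < q ^ e ->
  digit_sum q (q ^ e + y) = (digit_sum q y).+1.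
Proof.
by move=> q_gt1 lt_y; rewrite -[q ^ e]mul1n digit_sum_concat ?digit_sum1.
Qed.

Lemma digit_sum_exp_pred q k : 1 < q -> digit_sum q (q ^ k).-1 = q.-1 * k.
Proof.
move=> q_gt1; elim: k => [|k IHk]; first by rewrite digit_sum0 muln0.
have -> : (q ^ k.+1).-1 = q * (q ^ k).-1 + q.-1.
  by have := expn_gt0 q k; rewrite expnS; nia.
by rewrite digit_sum_mulD ?IHk ?mulnSr //; lia.
Qed.

(** The witness is the repunit made of [t] digits 1. *)
Lemma digit_sum_surj q t : 1 < q ->
  exists2 w, w < q ^ t & digit_sum q w = t.
Proof.
move=> q_gt1; elim: t => [|t [w lt_w sw]].
  by exists 0; rewrite ?digit_sum0.
by exists (q * w + 1); rewrite ?digit_sum_mulD ?sw ?addn1 // expnS; nia.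
Qed.

(* [j] is the number of trailing zeros of [x]. *)
Lemma digit_sum_pred q x : 1 < q -> 0 < x ->
  exists j, (digit_sum q x.-1).+1 = digit_sum q x + q.-1 * j.
Proof.
move=> q_gt1; elim/ltn_ind: x => x IHx x_gt0.
have := ltn_mod x q; have := divn_eq x q; rewrite (ltnW q_gt1) mulnC.
move: (x %/ q) (x %% q) => y [|d] def_x lt_d; last first.
  exists 0; rewrite muln0 addn0 def_x digit_sum_mulD // addnS /=.
  by rewrite digit_sum_mulD ?addnS // ltnW.
have y_gt0 : 0 < y
  by case: y def_x => // def_x; move: x_gt0; rewrite def_x muln0.
have [|j sy] := IHx y _ y_gt0; first by rewrite def_x; nia.
exists j.+1; rewrite def_x digit_sum_mulD //.
have -> : (q * y + 0).-1 = q * y.-1 + q.-1 by nia.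
rewrite digit_sum_mulD; [rewrite -addSn sy mulnSr; lia | lia | lia].
Qed.

(** The borrow runs through the [k] appended zeros and turns each into [q - 1]. *)
Lemma digit_sum_pred_shift q x k : 1 < q -> 0 < x ->
  digit_sum q (x * q ^ k).-1 = digit_sum q x.-1 + q.-1 * k.
Proof.
move=> q_gt1 x_gt0; have qk_gt0 : 0 < q ^ k by rewrite expn_gt0 ltnW.
have -> : (x * q ^ k).-1 = x.-1 * q ^ k + (q ^ k).-1 by nia.
by rewrite digit_sum_concat ?digit_sum_exp_pred // ltn_predL.
Qed.

(** Take for [g] the number with [n] digits 1 spaced [h] places apart: as [h < q ^ h], the [n]
    copies of [h] in [h * g] do not overlap. *)
Lemma digit_sum_multiple q h n : 1 < q -> 0 < h -> 0 < n ->
  exists2 g, 0 < g & digit_sum q (h * g) = n * digit_sum q h.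
Proof.
move=> q_gt1 h_gt0; case: n => // n _; elim: n => [|n [g g_gt0 sg]].
  by exists 1; rewrite // muln1 mul1n.
exists (g * q ^ h + 1); first by rewrite addn1.
have -> : h * (g * q ^ h + 1) = h * g * q ^ h + h by rewrite mulnDr mulnA muln1.
by rewrite (digit_sum_concat _ q_gt1 (ltn_expl h q_gt1)) sg addnC -mulSn.
Qed.

(** * Bounds on powers from AM-GM *)

Lemma weighted_AGM (a b c x y z s : nat) :
  a * x + b * y + c * z = (a + b + c) * s ->
  x ^ a * y ^ b * z ^ c <= s ^ (a + b + c).
Proof.
move=> mean_eq.
pose T : finType := ('I_a + 'I_b + 'I_c)%type.
pose E (i : T) : rat :=
  match i with inl (inl _) => x%:R | inl (inr _) => y%:R | inr _ => z%:R end%R.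
have E_ge0 : {in T, forall i, 0 <= E i}%R.
  by move=> [[i|i]|i] _; rewrite /E ler0n.
have := (leif_AGM E_ge0).1.
have cardT : #|T| = a + b + c by rewrite !card_sum !card_ord.
rewrite !big_sumType /= !prodr_const !sumr_const !card_ord.
have [n0 _ | n_gt0] := posnP (a + b + c).
  by move: n0; case: (a); case: (b); case: (c); rewrite // !expn0.
rewrite cardT -!mulrnA -!natrD (mulnC x) (mulnC y) (mulnC z) mean_eq natrM.
rewrite [X in (X / _)%R]mulrC mulfK ?pnatr_eq0 -?lt0n //.
by rewrite -!natrX -!natrM ler_nat.
Qed.

(* AM-GM for [h] copies of [A + m n] and [m - h] copies of [A] only gives the
   bound without the [+ 1]. As [m > 2 h], each of the [h] factors [A + m n] can
   first trade one unit with its own factor [A]: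
   [(A + m n - 1) (A + 1) >= A ^ 2 + m n A + 1]. *)
Lemma root_upper A n h m : 0 < n -> 2 < m -> h.*2 < m ->
  A ^ (m - h.*2) * (A ^ 2 + m * n * A + 1) ^ h <= (A + h * n) ^ m.
Proof.
move=> n_gt0 m_gt2 lt_hm; have def_m : h + h + (m - h.*2) = m by lia.
have mean : h * (A + m * n).-1 + h * A.+1 + (m - h.*2) * A
    = (h + h + (m - h.*2)) * (A + h * n).
  have [d def_d] : exists d, m = h.*2 + d by exists (m - h.*2); lia.
  have -> : m - h.*2 = d by lia.
  have [p def_p] : exists p, m * n = p.+1 by exists (m * n).-1; nia.
  rewrite def_p addnS /=; subst m; nia.
have := weighted_AGM mean; rewrite def_m; apply: leq_trans.
rewrite mulnC leq_mul2r -expnMn; apply/orP; right.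
case: h => [|h] in lt_hm def_m mean * => //; rewrite leq_exp2r //.
by have [p ->] : exists p, m * n = p.+3 by [exists (m * n - 3); nia]; nia.
Qed.

(* AM-GM bounds the complementary product [A ^ h * (A + m n) ^ (m - h)] from
   above; the two products multiply to [(A * (A + m n)) ^ m]. *)
Lemma root_lower A n h m : 0 < n -> 0 < h -> h <= m -> 0 < A ->
  (h * n).-1 * ((m - h) * n) <= A ->
  (A + (h * n).-1) ^ m <= A ^ (m - h) * (A + m * n) ^ h.
Proof.
move=> n_gt0 h_gt0 le_hm A_gt0 A_big.
have [d def_d] : exists d, m = h + d by exists (m - h); lia.
have def_mh : m - h = d by lia.
rewrite def_mh in A_big *.
have := @weighted_AGM h d 0 A (A + m * n) 0 (A + d * n).
rewrite !addn0 muln1 -def_d => /(_ _) HM.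
have {}HM : A ^ h * (A + m * n) ^ d <= (A + d * n) ^ m.
  by apply: HM; subst m; nia.
have gt0 : 0 < A ^ h * (A + m * n) ^ d.
  by rewrite muln_gt0 !expn_gt0 addn_gt0 A_gt0.
rewrite -(leq_pmul2r gt0).
apply: leq_trans (leq_mul (leqnn _) HM) _.
have -> : A ^ d * (A + m * n) ^ h * (A ^ h * (A + m * n) ^ d)
   = (A * (A + m * n)) ^ m.
  by rewrite expnMn def_d !expnD; lia.
rewrite -expnMn; case: m => [|m] in def_d HM le_hm def_mh gt0 * => //.
rewrite leq_exp2r //.
(* What remains is [(A + (h n - 1)) (A + d n) <= A (A + m n)]. The right side exceeds the left by
   [A - (h n - 1) d n], which [A_big] makes nonnegative. *)
have [p def_p] : exists p, h * n = p.+1 by exists (h * n).-1; nia.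
rewrite def_p /= in A_big *.
have -> : m.+1 * n = p.+1 + d * n by rewrite def_d mulnDl def_p.
nia.
Qed.

Lemma root_window Q h m n w : 0 < n -> 0 < h -> 2 < m -> h.*2 < m ->
  0 < Q -> (h * n).-1 * ((m - h) * n) <= Q ^ h -> w < Q ^ (m - h.*2) ->
  (Q ^ h + (h * n).-1) ^ m <= (Q ^ (m - h) * (Q ^ h + m * n) + w) ^ h
    < (Q ^ h + (h * n).-1).+1 ^ m.
Proof.
move=> n_gt0 h_gt0 m_gt2 lt_hm Q_gt0 Q_big lt_w.
have A_gt0 : 0 < Q ^ h by rewrite expn_gt0 Q_gt0.
have le_hm : h <= m by lia.
have powA e : (Q ^ h) ^ e = (Q ^ e) ^ h by rewrite -!expnM mulnC.
apply/andP; split.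
  apply: leq_trans (root_lower n_gt0 h_gt0 le_hm A_gt0 Q_big) _.
  by rewrite powA -expnMn leq_exp2r ?leq_addr.
have -> : (Q ^ h + (h * n).-1).+1 = Q ^ h + h * n.
  by rewrite -addnS prednK // muln_gt0 h_gt0.
apply: leq_trans (root_upper _ n_gt0 m_gt2 lt_hm).
rewrite powA -expnMn ltn_exp2r //.
(* With [A = Q ^ h] and [P = Q ^ (m - 2 h)], the base is [P (A ^ 2 + m n A) + w]; the [+ 1] of
   [root_upper] is worth one [P], more than [w]. *)
have -> : Q ^ (m - h) = Q ^ (m - h.*2) * Q ^ h.
  by rewrite -expnD; congr (_ ^ _); lia.
by move: (Q ^ h) (Q ^ _) lt_w => A P lt_w; nia.
Qed.

(** * Choice of [u] and [v] *)

Lemma digit_sum_ratio q h m a b : 1 < q -> 0 < h -> 2 < m -> h.*2 < m ->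
    0 < a -> 0 < b ->
  exists u v, [/\ v ^ m <= u ^ h < v.+1 ^ m, 0 < u, 0 < digit_sum q u
    & digit_sum q v * b = a * digit_sum q u].
Proof.
move=> q_gt1 h_gt0 m_gt2 lt_hm a_gt0 b_gt0; have q_gt0 := ltnW q_gt1.
have le_hm : h <= m by lia.
have [g g_gt0 sg] := digit_sum_multiple q_gt1 h_gt0 a_gt0.
have hg_gt0 : 0 < h * g by rewrite muln_gt0 h_gt0.
have [j sj] := digit_sum_pred q_gt1 hg_gt0.
(* [c] will be the digit sum of [u0], the successor counting the leading 1 of [Q ^ h]. *)
set c := (digit_sum q (m * g)).+1.
(* This [k] gives [j + k = a (c + j)], so that [a] divides the digit sum of [v]. The term [c]
   ensures [c <= X], hence [b * X - c] is not truncated. *)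
pose k := a * (c + j) - j; pose n := g * q ^ k.
have n_gt0 : 0 < n by rewrite muln_gt0 g_gt0 expn_gt0 q_gt0.
pose X := digit_sum q h + q.-1 * (c + j).
have sv : (digit_sum q (h * n).-1).+1 = a * X.
  rewrite mulnA digit_sum_pred_shift // -addSn sj sg -addnA -mulnDr.
  have -> : j + k = a * (c + j) by rewrite /k subnKC //; nia.
  by rewrite (mulnCA _ a) -mulnDr.
have le_cX : c <= b * X.
  have le_c : c <= X by rewrite /X; move: (q.-1) (ltn_predRL 0 q) => p; nia.
  by apply: leq_trans le_c _; rewrite leq_pmull.
have smn : (digit_sum q (m * n)).+1 = c by rewrite mulnA digit_sum_shift.
have [w lt_w sw] := digit_sum_surj (b * X - c) q_gt1.
(* Each summand serves one bound: [w] fits in the free low digits, [m * n < Q ^ h], and the size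
   condition of [root_window] holds. *)
pose l := (b * X - c) + m * n + (h * n).-1 * ((m - h) * n).
pose Q := q ^ l.
have lt_lQ : l < Q by exact: ltn_expl.
have le_QA : Q <= Q ^ h by rewrite -[leqLHS]expn1 leq_pexp2l ?expn_gt0 ?q_gt0.
have lt_mn : m * n < Q ^ h.
  apply: leq_trans le_QA; apply: leq_trans lt_lQ.
  by rewrite ltnS /l -addnA addnCA leq_addr.
have lt_hn : (h * n).-1 < Q ^ h.
  apply: leq_ltn_trans lt_mn; apply: leq_trans (leq_pred _) _.
  by rewrite leq_mul2r le_hm orbT.
have lt_wQ : w < Q ^ (m - h.*2).
  apply: leq_trans lt_w _; rewrite -expnM leq_pexp2l //.
  by rewrite -[leqLHS]muln1 leq_mul // ?subn_gt0 // /l -addnA leq_addr.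
have lt_wQ' : w < Q ^ (m - h).
  by apply: leq_trans lt_wQ _; rewrite leq_pexp2l ?expn_gt0 ?q_gt0 //; lia.
exists (Q ^ (m - h) * (Q ^ h + m * n) + w), (Q ^ h + (h * n).-1).
have su : digit_sum q (Q ^ (m - h) * (Q ^ h + m * n) + w) = b * X.
  move: lt_mn lt_wQ'; rewrite /Q -!expnM => lt_mn lt_wQ'.
  by rewrite mulnC digit_sum_concat // digit_sum_expD // smn sw subnKC.
have sv' : digit_sum q (Q ^ h + (h * n).-1) = a * X.
  by move: lt_hn; rewrite /Q -!expnM => lt_hn; rewrite digit_sum_expD.
split.
- apply: root_window => //; first by rewrite expn_gt0 q_gt0.
  by apply: leq_trans le_QA; apply: leq_trans (ltnW lt_lQ); rewrite leq_addl.
- by rewrite addn_gt0 muln_gt0 !(expn_gt0, addn_gt0) q_gt0.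
- by rewrite su; apply: leq_trans le_cX.
- by rewrite su sv' -mulnA [X * b]mulnC.
Qed.

Local Open Scope ring_scope.

(** The [m]-th power of the real number is [u ^ h], and [m]-th powers preserve and reflect order on
    nonnegative reals. *)
Lemma floor_powR_ratio (R : realType) (u v h m : nat) :
  (0 < m)%N -> (v ^ m <= u ^ h < v.+1 ^ m)%N ->
  Num.floor (u%:R `^ (h%:R / m%:R) : R) = v%:Z.
Proof.
move=> m_gt0 /andP[le_v lt_v]; apply: floor_def.
set x : R := _ `^ _; have x_ge0 : 0 <= x by exact: powR_ge0.
have xm : x ^+ m = (u ^ h)%:R.
  rewrite natrX -powR_mulrn // -powRrM mulfVK ?pnatr_eq0 -?lt0n //.
  by rewrite powR_mulrn.
have -> : (v%:Z + 1)%:~R = v.+1%:R :> R by rewrite -addn1.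
rewrite -(ler_pXn2r m_gt0) ?nnegrE // -(ltr_pXn2r m_gt0) ?nnegrE //.
by rewrite xm -!natrX ler_nat ltr_nat le_v.
Qed.

Theorem theorem4p1 (R : realType) (r : rat) (q h m : nat)
    (hr : 0 < r) (hq : (2 <= q)%N) (hh : (1 <= h)%N) (hm : (3 <= m)%N)
    (hcop : gcdn h m = 1%N) (hlt : h%:R / m%:R < 1 / 2 :> rat) :
  exists u : nat,
    (0 < u)%N /\
    (digit_sum q `|Num.floor (u%:R `^ (h%:R / m%:R) : R)|)%:R
      / (digit_sum q u)%:R = r.
Proof.
have m_gt0 : (0 < m)%N by exact: ltnW (ltnW hm).
have lt_hm : (h.*2 < m)%N.
  move: hlt; rewrite ltr_pdivrMr ?ltr0n // mulrAC ltr_pdivlMr ?ltr0n //.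
  by rewrite mul1r -natrM ltr_nat muln2.
have def_r : r = `|numq r|%N%:R / `|denq r|%N%:R.
  by rewrite -[LHS]divq_num_den !natr_absz !gtr0_norm ?denq_gt0 ?numq_gt0.
have a_gt0 : (0 < `|numq r|)%N by rewrite absz_gt0 numq_eq0 gt_eqF.
have b_gt0 : (0 < `|denq r|)%N by rewrite absz_gt0 denq_eq0.
have [u [v [uv u_gt0 su_gt0 ratio]]] :=
  digit_sum_ratio hq hh hm lt_hm a_gt0 b_gt0.
exists u; split=> //; rewrite (floor_powR_ratio R m_gt0 uv) /= def_r.
by apply/eqP; rewrite eqr_div ?pnatr_eq0 -?lt0n // -!natrM ratio.
Qed.
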